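(* Let $\Bbbk$ be a commutative ring and let $\mathcal{C}$ be a $\Bbbk$-linear strict monoidal category presented by generating objects $\mathcal{N}$, generating morphisms $\mathcal{S}$ and relations $\mathcal{R}$. Let $\bar X$ be the set of diagrams built from $\mathcal{S}$ up to rectilinear isotopy. Suppose $\le$ is a partial order on $\bar X$ which respects the morphism spaces, is a monoidal partial ordering, is compatible with $\mathcal{R}$, and satisfies the descending chain condition. Then the following are equivalent: (1) the irreducible diagrams $\bar X_{\mathrm{irr}}$ form a basis for $\mathcal{C}$, i.e. for all objects $n,m$ the irreducible diagrams from $n$ to $m$ form a $\Bbbk$-basis of $\operatorname{Hom}_{\mathcal{C}}(n,m)$; (2) every ambiguity is resolvable; (3) every ambiguity is resolvable relative to $\le$. Moreover, if $M$ is a minimal set of ambiguities (accounting for each type of ambiguity), then these conditions are also equivalent to each of: (4) every ambiguity in $M$ is resolvable; (5) every ambiguity in $M$ is resolvable relative to $\le$. If these conditions are true, the data of the presentation and the partial order is said to be of monoidal Bergman type.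
   Context: Objects of $\mathcal{C}$ are words in $\mathcal{N}$. A diagram is a string diagram built from generators in $\mathcal{S}$ by vertical composition and horizontal composition $\otimes$. Rectilinear isotopy is the equivalence relation generated by the interchange law of a strict monoidal category; thus $\bar X(n,m)$, the set of isotopy classes of diagrams from $n$ to $m$, is the set of morphisms $n\to m$ in the free strict monoidal category on $\mathcal{N},\mathcal{S}$. Each relation $r\in\mathcal{R}$ is a $\Bbbk$-linear combination of elements of a single $\bar X(n,m)$ that is set to zero, and $\operatorname{Hom}_{\mathcal{C}}(n,m)$ is the quotient of $\Bbbk\cdot\bar X(n,m)$ by all consequences of relations under vertical and horizontal composition. Plugging a diagram $B\colon p\to q$ into a larger diagram means forming $T\circ(\operatorname{id}_a\otimes B\otimes\operatorname{id}_b)\circ U$ for objects $a,b$ and diagrams $T,U$; $B$ is then a subdiagram of the result. Conditions on the partial order $\le$ on $\bar X$: * it respects morphism spaces if elements of $\bar X(n,m)$ and $\bar X(n',m')$ are incomparable unless $n=n'$ and $m=m'$; * it is a monoidal partial ordering if $B<B'$ implies $\varphi<\psi$ whenever $\varphi$ and $\psi$ are obtained by plugging $B$ and $B'$, respectively, into the same larger diagram; * it is compatible with $\mathcal{R}$ if each $r\in\mathcal{R}$ can be rewritten as an equation $W_r=f_r$ with $W_r\in\bar X$ and $f_r$ a $\Bbbk$-linear combination of elements $A\in\bar X$ with $A<W_r$. An elementary resolution is a $\Bbbk$-linear map on $\Bbbk\cdot\bar X$ sending one diagram $T\circ(\operatorname{id}_a\otimes W_r\otimes\operatorname{id}_b)\circ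 U$ to $T\circ(\operatorname{id}_a\otimes f_r\otimes\operatorname{id}_b)\circ U$ and fixing every other diagram. A resolution is a composition of elementary resolutions. A diagram is irreducible if it is fixed by every resolution, i.e. contains no subdiagram $W_r$. $\bar X_{\mathrm{irr}}$ is the set of irreducible diagrams. An ambiguity $(A,W_r,W_s)$ is a diagram $A\in\bar X$ together with two specified subdiagrams $W_r$ and $W_s$ ($r,s\in\mathcal{R}$), which are either distinct subdiagrams, or the same subdiagram with $r\ne s$. It gives two elementary resolutions $\rho_r(A),\rho_s(A)$ of $A$, obtained by replacing the specified $W_r$ by $f_r$, respectively $W_s$ by $f_s$. The ambiguity is resolvable if further resolutions can be applied to $\rho_r(A)$ and to $\rho_s(A)$ to arrive at the same element of $\Bbbk\cdot\bar X$. Let $I_{<A}$ be the $\Bbbk$-span of all $T\circ(\operatorname{id}_a\otimes(W_r-f_r)\otimes\operatorname{id}_b)\circ U$ with $T\circ(\operatorname{id}_a\otimes W_r\otimes\operatorname{id}_b)\circ U<A$. The ambiguity is resolvable relative to $\le$ if $\rho_r(A)-\rho_s(A)\in I_{<A}$. A family $M$ of ambiguities is a minimal set of ambiguities if, when all members of $M$ are resolvable, every ambiguity is resolvable. (No minimality in the literal sense is required; for example, $M$ could be the set of all ambiguities.)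
   Formalization: That (5) implies the other conditions is stated only for M such that, when all members of M are resolvable relative to ≤, every ambiguity is; with M minimal only for resolvability that implication is false. *)

(* Defs.v *)
From HB Require Import structures.
From mathcomp Require Import all_boot all_algebra.
From mathcomp Require Import generic_quotient ring_quotient finmap.
From mathcomp.multinomials Require Import monalg.
From mathcomp Require Import boolp.

Set Implicit Arguments.
Unset Strict Implicit.
Unset Printing Implicit Defensive.

Import GRing.Theory.

Local Open Scope ring_scope.
Local Open Scope quotient_scope.

(* The carrier is the one of [{malg k[K]}], whose own module structure is only
   declared over nontrivial rings. *)
Definition lincomb (k : comPzRingType) (K : choiceType) : Type := {malg k[K]}.

Section LinearCombinations.
Variables (k : comPzRingType) (K : choiceType).

HB.instance Definition _ := GRing.Zmodule.on (lincomb k K).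

Definition scale_lincomb (a : k) (x : lincomb k K) : lincomb k K :=
  [malg i in msupp x => a * x@_i].

Lemma scale_lincombE a x i : (scale_lincomb a x)@_i = a * x@_i.
Proof. by rewrite mcoeffE; case: msuppP; rewrite ?mulr0. Qed.

Fact scale_lincombA a b x :
  scale_lincomb a (scale_lincomb b x) = scale_lincomb (a * b) x.
Proof. by apply/malgP=> i; rewrite !scale_lincombE mulrA. Qed.

Fact scale_lincomb1 : left_id 1 scale_lincomb.
Proof. by move=> x; apply/malgP=> i; rewrite scale_lincombE mul1r. Qed.

Fact scale_lincombDr : right_distributive scale_lincomb +%R.
Proof.
by move=> a x y; apply/malgP=> i; rewrite !(scale_lincombE, mcoeffD) mulrDr.
Qed.

Fact scale_lincombDl x : {morph scale_lincomb^~ x : a b / a + b}.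
Proof.
by move=> a b; apply/malgP=> i; rewrite !(scale_lincombE, mcoeffD) mulrDl.
Qed.

HB.instance Definition _ := GRing.Zmodule_isLmodule.Build k (lincomb k K)
  scale_lincombA scale_lincomb1 scale_lincombDr scale_lincombDl.

Definition single (i : K) : lincomb k K := << i >>.

Definition linext (V : lmodType k) (e : K -> V) (x : lincomb k K) : V :=
  \sum_(i <- msupp x) x@_i *: e i.

(* The family [e i], with [i] ranging over [P], is a basis of [V]. *)
Definition is_basis (V : lmodType k) (P : K -> Prop) (e : K -> V) : Prop :=
  (forall x : lincomb k K,
     (forall i, i \in msupp x -> P i) -> linext e x = 0 -> x = 0)
  /\ (forall v : V, exists2 x : lincomb k K,
        forall i, i \in msupp x -> P i & v = linext e x).

Inductive lin_span (V : lmodType k) (G : V -> Prop) : V -> Prop :=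
  | lin_span0 : lin_span G 0
  | lin_spanD a x y : G x -> lin_span G y -> lin_span G (a *: x + y).

End LinearCombinations.

Arguments single {k K} i.

Record signature := Signature {
  obj : Type;
  gen : Type;
  gsrc : gen -> seq obj;
  gtgt : gen -> seq obj
}.

(* [Comp t u] is "t after u". *)
Inductive term (Sg : signature) : seq (obj Sg) -> seq (obj Sg) -> Type :=
  | Id a : term a a
  | Gen s : term (gsrc s) (gtgt s)
  | Comp n p m : term p m -> term n p -> term n m
  | Tens n m n' m' : term n m -> term n' m' -> term (n ++ n') (m ++ m').

Arguments Id {Sg} a.
Arguments Gen {Sg} s.

(* The congruence generated by the axioms of strict monoidal categories.  It is
   heterogeneous because the two sides of the associativity and unit laws of the
   tensor product have types that are only propositionally equal. *)
Inductive isotopic (Sg : signature) : forall n m n' m' : seq (obj Sg),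
    term n m -> term n' m' -> Prop :=
  | iso_refl n m (t : term n m) : isotopic t t
  | iso_sym n m n' m' (t : term n m) (t' : term n' m') :
      isotopic t t' -> isotopic t' t
  | iso_trans n m n' m' n'' m''
      (t : term n m) (t' : term n' m') (t'' : term n'' m'') :
      isotopic t t' -> isotopic t' t'' -> isotopic t t''
  | iso_Comp n p m n' p' m' (t : term p m) (u : term n p)
      (t' : term p' m') (u' : term n' p') :
      isotopic t t' -> isotopic u u' -> isotopic (Comp t u) (Comp t' u')
  | iso_Tens n1 m1 n2 m2 n1' m1' n2' m2' (t : term n1 m1) (u : term n2 m2)
      (t' : term n1' m1') (u' : term n2' m2') :
      isotopic t t' -> isotopic u u' -> isotopic (Tens t u) (Tens t' u')
  | iso_CompA n p q m (t : term q m) (u : term p q) (v : term n p) :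
      isotopic (Comp t (Comp u v)) (Comp (Comp t u) v)
  | iso_Comp1l n m (t : term n m) : isotopic (Comp (Id m) t) t
  | iso_Comp1r n m (t : term n m) : isotopic (Comp t (Id n)) t
  | iso_TensA n1 m1 n2 m2 n3 m3
      (t : term n1 m1) (u : term n2 m2) (v : term n3 m3) :
      isotopic (Tens t (Tens u v)) (Tens (Tens t u) v)
  | iso_Tens1l n m (t : term n m) : isotopic (Tens (Id [::]) t) t
  | iso_Tens1r n m (t : term n m) : isotopic (Tens t (Id [::])) t
  | iso_Tens_Id a b : isotopic (Tens (Id a) (Id b)) (Id (a ++ b))
  | iso_interchange n p m n' p' m' (t : term p m) (u : term n p)
      (t' : term p' m') (u' : term n' p') :
      isotopic (Comp (Tens t t') (Tens u u')) (Tens (Comp t u) (Comp t' u')).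

HB.instance Definition _ (Sg : signature) (n m : seq (obj Sg)) :=
  gen_eqMixin (term n m).
HB.instance Definition _ (Sg : signature) (n m : seq (obj Sg)) :=
  gen_choiceMixin (term n m).

Section Diagrams.
Variable Sg : signature.
Implicit Types n m p q a b : seq (obj Sg).

Definition isotopicb n m : rel (term n m) := fun t u => `[< isotopic t u >].

Fact isotopicb_refl n m : reflexive (@isotopicb n m).
Proof. by move=> t; apply/asboolP; apply: iso_refl. Qed.

Fact isotopicb_sym n m : symmetric (@isotopicb n m).
Proof. by move=> t u; apply/asboolP/asboolP; apply: iso_sym. Qed.

Fact isotopicb_trans n m : transitive (@isotopicb n m).
Proof.
by move=> u t v /asboolP tu /asboolP uv; apply/asboolP; apply: iso_trans tu uv.
Qed.

Canonical isotopicb_equiv n m := EquivRel (@isotopicb n m)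
  (@isotopicb_refl n m) (@isotopicb_sym n m) (@isotopicb_trans n m).

Definition diagram n m := {eq_quot @isotopicb n m}.

Definition idd a : diagram a a := \pi_(diagram a a) (Id a).

Definition vcomp n p m (T : diagram p m) (U : diagram n p) : diagram n m :=
  \pi_(diagram n m) (Comp (repr T) (repr U)).

Definition hcomp n m n' m' (T : diagram n m) (U : diagram n' m') :
    diagram (n ++ n') (m ++ m') :=
  \pi_(diagram (n ++ n') (m ++ m')) (Tens (repr T) (repr U)).

Lemma isotopic_repr n m (t : term n m) :
  isotopic (repr (\pi_(diagram n m) t)) t.
Proof.
suff: isotopicb (repr (\pi_(diagram n m) t)) t by move/asboolP.
by apply/eqmodP; rewrite reprK.
Qed.

Lemma vcompE n p m (t : term p m) (u : term n p) :
  vcomp (\pi_(diagram p m) t) (\pi_(diagram n p) u) =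
  \pi_(diagram n m) (Comp t u).
Proof.
by apply/eqmodP/asboolP; apply: iso_Comp; apply: isotopic_repr.
Qed.

Lemma hcompE n m n' m' (t : term n m) (u : term n' m') :
  hcomp (\pi_(diagram n m) t) (\pi_(diagram n' m') u) =
  \pi_(diagram (n ++ n') (m ++ m')) (Tens t u).
Proof.
by apply/eqmodP/asboolP; apply: iso_Tens; apply: isotopic_repr.
Qed.

Record anydiagram := AnyDiagram {
  dsrc : seq (obj Sg);
  dtgt : seq (obj Sg);
  dmor :> diagram dsrc dtgt
}.

HB.instance Definition _ := gen_eqMixin anydiagram.

(* A diagram from [n] to [m] with a hole to be filled by diagrams from [p] to
   [q]. *)
Record placement n m p q := Placement {
  pleft : seq (obj Sg);
  pright : seq (obj Sg);
  ptop : diagram (pleft ++ (q ++ pright)) m;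
  pbot : diagram n (pleft ++ (p ++ pright))
}.

Definition plug n m p q (c : placement n m p q) (B : diagram p q) :
    diagram n m :=
  vcomp (ptop c) (vcomp (hcomp (idd (pleft c)) (hcomp B (idd (pright c))))
                        (pbot c)).

Definition lplug (k : comPzRingType) n m p q (c : placement n m p q)
    (x : lincomb k (diagram p q)) : lincomb k (diagram n m) :=
  linext (fun B => single (plug c B)) x.

End Diagrams.

Arguments AnyDiagram {Sg dsrc dtgt} dmor.
Arguments idd {Sg} a.

(* An occurrence of a subdiagram is recorded by replacing it with a box,
   i.e. an additional generator.  Two placements specify the same subdiagram
   when the resulting diagrams with a box are isotopic. *)
Section Boxes.
Variables (Sg : signature) (I : Type) (bsrc btgt : I -> seq (obj Sg)).

Definition box_signature : signature :=
  {| obj := obj Sg;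
     gen := gen Sg + I;
     gsrc := fun x => match x with inl s => gsrc s | inr r => bsrc r end;
     gtgt := fun x => match x with inl s => gtgt s | inr r => btgt r end |}.

Implicit Types n m : seq (obj Sg).

Fixpoint embed_term n m (t : @term Sg n m) : @term box_signature n m :=
  match t in term n' m' return @term box_signature n' m' with
  | Id a => @Id box_signature a
  | Gen s => @Gen box_signature (inl s)
  | Comp _ _ _ u v => Comp (embed_term u) (embed_term v)
  | Tens _ _ _ _ u v => Tens (embed_term u) (embed_term v)
  end.

Definition embed n m (A : @diagram Sg n m) : @diagram box_signature n m :=
  \pi_(@diagram box_signature n m) (embed_term (repr A)).

Definition boxed n m r (c : @placement Sg n m (bsrc r) (btgt r)) :
    @diagram box_signature n m :=
  plug (@Placement box_signature n m (bsrc r) (btgt r) (pleft c) (pright c)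
          (embed (ptop c)) (embed (pbot c)))
       (\pi_(@diagram box_signature (bsrc r) (btgt r))
          (@Gen box_signature (inr r))).

End Boxes.

Record presentation (k : comPzRingType) := Presentation {
  sig :> signature;
  relT : Type;
  rsrc : relT -> seq (obj sig);
  rtgt : relT -> seq (obj sig);
  relator : forall r, lincomb k (diagram (rsrc r) (rtgt r))
}.

Section PresentedCategory.
Variables (k : comPzRingType) (P : presentation k).
Implicit Types n m p q : seq (obj P).

(* The two-sided monoidal ideal generated by the relators. *)
Inductive consequence : forall n m, lincomb k (diagram n m) -> Prop :=
  | cons_relator r : consequence (relator (p := P) r)
  | cons0 n m : consequence (0 : lincomb k (diagram n m))
  | cons_lin n m a (x y : lincomb k (diagram n m)) :
      consequence x -> consequence y -> consequence (a *: x + y)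
  | cons_vcompl n p m (T : diagram p m) (x : lincomb k (diagram n p)) :
      consequence x -> consequence (linext (fun A => single (vcomp T A)) x)
  | cons_vcompr n p m (U : diagram n p) (x : lincomb k (diagram p m)) :
      consequence x -> consequence (linext (fun A => single (vcomp A U)) x)
  | cons_hcompl n m n' m' (T : diagram n' m') (x : lincomb k (diagram n m)) :
      consequence x -> consequence (linext (fun A => single (hcomp T A)) x)
  | cons_hcompr n m n' m' (T : diagram n' m') (x : lincomb k (diagram n m)) :
      consequence x -> consequence (linext (fun A => single (hcomp A T)) x).

Definition consequenceb n m : {pred lincomb k (diagram n m)} :=
  fun x => `[< consequence x >].

Fact consequenceb_zmod n m : zmod_closed (@consequenceb n m).
Proof.
split=> [|x y /asboolP x0 /asboolP y0]; apply/asboolP; first exact: cons0.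
by rewrite addrC -scaleN1r; apply: cons_lin.
Qed.

HB.instance Definition _ n m :=
  GRing.isZmodClosed.Build _ (@consequenceb n m) (@consequenceb_zmod n m).

Definition HomC n m : Type := Quotient.quot (@consequenceb n m).

HB.instance Definition _ n m := GRing.Zmodule.on (HomC n m).

Definition toHom n m (x : lincomb k (diagram n m)) : HomC n m :=
  \pi_(Quotient.quot (@consequenceb n m)) x.

Definition scale_Hom n m (a : k) (x : HomC n m) : HomC n m :=
  toHom (a *: repr (x : Quotient.quot (@consequenceb n m))).

Fact toHomD n m : {morph @toHom n m : x y / x + y}.
Proof. by move=> x y; rewrite /toHom raddfD. Qed.

Lemma toHomZ n m a (x : lincomb k (diagram n m)) :
  toHom (a *: x) = scale_Hom a (toHom x).
Proof.
rewrite /scale_Hom /toHom.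
set y := repr _; have xy : consequence (x - y).
  have: x - y \in @consequenceb n m by rewrite Quotient.idealrBE /y reprK.
  by move/asboolP.
apply/eqP; rewrite -Quotient.idealrBE; apply/asboolP.
by rewrite -scalerBr -[_ *: _]addr0; apply: cons_lin => //; apply: cons0.
Qed.

Fact toHom_surj n m (x : HomC n m) : exists y, x = toHom y.
Proof.
by exists (repr (x : Quotient.quot (@consequenceb n m))); rewrite /toHom reprK.
Qed.

Fact scale_HomA n m a b (x : HomC n m) :
  scale_Hom a (scale_Hom b x) = scale_Hom (a * b) x.
Proof. by have [y ->] := toHom_surj x; rewrite -!toHomZ scalerA. Qed.

Fact scale_Hom1 n m : left_id 1 (@scale_Hom n m).
Proof. by move=> x; have [y ->] := toHom_surj x; rewrite -toHomZ scale1r. Qed.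

Fact scale_HomDr n m : right_distributive (@scale_Hom n m) +%R.
Proof.
move=> a x x'; have [y ->] := toHom_surj x; have [y' ->] := toHom_surj x'.
by rewrite -toHomD -!toHomZ -toHomD scalerDr.
Qed.

Fact scale_HomDl n m (x : HomC n m) :
  {morph (@scale_Hom n m)^~ x : a b / a + b}.
Proof.
by move=> a b; have [y ->] := toHom_surj x; rewrite -!toHomZ -toHomD scalerDl.
Qed.

HB.instance Definition _ n m := GRing.Zmodule_isLmodule.Build k (HomC n m)
  (@scale_HomA n m) (@scale_Hom1 n m) (@scale_HomDr n m) (@scale_HomDl n m).

End PresentedCategory.

(* For each relation [r], the diagram W_r and the linear combination f_r. *)
Record orientation (k : comPzRingType) (P : presentation k) := Orientation {
  lead : forall r : relT P, diagram (rsrc r) (rtgt r);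
  rest : forall r : relT P, lincomb k (diagram (rsrc r) (rtgt r))
}.

Section Rewriting.
Variables (k : comPzRingType) (P : presentation k) (O : orientation P).
Implicit Types n m p q : seq (obj P).

Definition elem_resolution n m (r : relT P)
    (c : placement n m (rsrc r) (rtgt r)) :
    lincomb k (diagram n m) -> lincomb k (diagram n m) :=
  linext (fun A => if A == plug c (lead O r) then lplug c (rest O r)
                   else single A).

Inductive resolution n m :
    (lincomb k (diagram n m) -> lincomb k (diagram n m)) -> Prop :=
  | resolution_id : resolution id
  | resolution_comp r (c : placement n m (rsrc r) (rtgt r)) rho :
      resolution rho -> resolution (elem_resolution c \o rho).

Definition irreducible n m (A : diagram n m) : Prop :=
  forall rho, resolution rho -> rho (single A) = single A.

Record ambiguity := Ambiguity {
  asrc : seq (obj P);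
  atgt : seq (obj P);
  adiag : diagram asrc atgt;
  arel1 : relT P;
  arel2 : relT P;
  apos1 : placement asrc atgt (rsrc arel1) (rtgt arel1);
  apos2 : placement asrc atgt (rsrc arel2) (rtgt arel2);
  adiag1 : adiag = plug apos1 (lead O arel1);
  adiag2 : adiag = plug apos2 (lead O arel2);
  (* Boxes are labelled by relations: this excludes only the same subdiagram
     taken twice with the same relation. *)
  adistinct : boxed apos1 <> boxed apos2
}.

Definition branch1 (a : ambiguity) : lincomb k (diagram (asrc a) (atgt a)) :=
  elem_resolution (apos1 a) (single (adiag a)).

Definition branch2 (a : ambiguity) : lincomb k (diagram (asrc a) (atgt a)) :=
  elem_resolution (apos2 a) (single (adiag a)).

Definition resolvable (a : ambiguity) : Prop :=
  exists rho1 rho2, [/\ resolution rho1, resolution rho2 &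
    rho1 (branch1 a) = rho2 (branch2 a)].

Section Order.
Variable le : rel (anydiagram P).

Definition lt (A B : anydiagram P) : bool := (A != B) && le A B.

Definition partial_order : Prop :=
  [/\ reflexive le, antisymmetric le & transitive le].

Definition respects_morphism_spaces : Prop :=
  forall n m n' m' (A : diagram n m) (B : diagram n' m'),
    le (AnyDiagram A) (AnyDiagram B) -> n = n' /\ m = m'.

Definition monoidal_order : Prop :=
  forall n m p q (c : placement n m p q) (B B' : diagram p q),
    lt (AnyDiagram B) (AnyDiagram B') ->
    lt (AnyDiagram (plug c B)) (AnyDiagram (plug c B')).

(* The relation [relator r = 0] is rewritten as the equation
   [lead O r = rest O r] by dividing it by a unit. *)
Definition compatible : Prop :=
  forall r : relT P,
    (exists u v : k, v * u = 1 /\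
       relator r = u *: (single (lead O r) - rest O r)) /\
    (forall A, A \in msupp (rest O r) ->
       lt (AnyDiagram A) (AnyDiagram (lead O r))).

Definition descending_chain_condition : Prop :=
  ~ exists A : nat -> anydiagram P, forall i, lt (A i.+1) (A i).

Definition ideal_below n m (A : diagram n m) :
    lincomb k (diagram n m) -> Prop :=
  lin_span (fun x => exists r (c : placement n m (rsrc r) (rtgt r)),
    lt (AnyDiagram (plug c (lead O r))) (AnyDiagram A) /\
    x = lplug c (single (lead O r) - rest O r)).

Definition relatively_resolvable (a : ambiguity) : Prop :=
  ideal_below (adiag a) (branch1 a - branch2 a).

End Order.

Definition irreducible_basis : Prop :=
  forall n m, is_basis (@irreducible n m)
    (fun A : diagram n m => toHom (P := P) (single A) : HomC n m).

(* [minimal_for resolvable M]: [M] is a minimal set of ambiguities.  Despite the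
   name no minimality is required.  Being minimal for relative resolvability is
   a different condition on [M]. *)
Definition minimal_for (Res : ambiguity -> Prop) (M : ambiguity -> Prop) :
    Prop :=
  (forall a, M a -> Res a) -> forall a, Res a.

End Rewriting.

(* Main.v *)
Require Import Defs.
From HB Require Import structures.
From mathcomp Require Import all_boot all_algebra.
From mathcomp Require Import generic_quotient ring_quotient finmap.
From mathcomp.multinomials Require Import monalg.
From mathcomp Require Import boolp.
From mathcomp Require Import zify.

(** Why the theorem is true.  Write [rule r] for W_r - f_r.  Up to the unit that
    normalizes each relator, the consequences of the relations are exactly the
    span of the elements [lplug c (rule r)] (lemmas [consequence_rule] and
    [consequence_span]): composing with, or tensoring by, a diagram turns a
    placement into a placement.

    From a basis to resolvability: the descending chain condition makes every
    linear combination reach a combination of irreducible diagrams after some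
    resolution ([normalizableP]).  Resolutions do not leave the class modulo
    consequences, so the normalizations of the two branches of an ambiguity
    represent the same morphism; the irreducible diagrams being independent,
    they are equal.

    From resolvability to relative resolvability: both branches of an ambiguity
    on A are supported strictly below A, and a resolution only moves such an
    element by multiples of [lplug c (rule r)] with [plug c (lead O r)] below A
    ([resolution_below]).

    From relative resolvability to a basis: irreducible diagrams span by
    normalization.  For their independence, choose one reduction for each
    reducible diagram and let N be the resulting linear normal form map, defined
    by well-founded recursion.  N fixes the irreducible diagrams, so it is
    enough that N kills every consequence, that is, every
    [lplug c (rule r)]; this is the diamond argument of [normal_form_rule], by
    induction on A = [plug c (lead O r)].  There, N(A) was computed from a
    chosen reduction [(s, d)] of A.  Either the two placements specify the same
    subdiagram, and both reductions agree, or they form an ambiguity, and the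
    difference of the two reductions lies in [ideal_below A], which N kills by
    induction.

    In the first of these two cases one only knows that the diagrams with a box
    are isotopic.  Counting boxes with a given label shows that r = s
    ([boxed_eq_label]), and substituting a diagram for the box shows that the
    two placements define the same plugging operation ([boxed_eq_plug]). *)

Set Implicit Arguments.
Unset Strict Implicit.
Unset Printing Implicit Defensive.

Import GRing.Theory.

Local Open Scope ring_scope.
Local Open Scope quotient_scope.

(** * Linear combinations and submodules *)

Section Linext.
Variables (k : comPzRingType) (K : choiceType).
Implicit Types (x y : lincomb k K) (V W : lmodType k).

Lemma linextEw V (e : K -> V) (d : {fset K}) x :
  {subset msupp x <= d} -> linext e x = \sum_(i <- d) x@_i *: e i.
Proof.
move=> sxd; apply: big_fset_incl; first exact/fsubsetP.
by move=> i _ ix; rewrite mcoeff_outdom // scale0r.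
Qed.

Lemma linext_linear V (e : K -> V) : linear (linext e).
Proof.
move=> a x y; pose d := (msupp x `|` msupp y)%fset.
rewrite !(@linextEw _ e d); try by move=> i; rewrite inE => ->; rewrite ?orbT.
  rewrite scaler_sumr -big_split; apply: eq_bigr => i _ /=.
  by rewrite mcoeffD (scale_lincombE a x) scalerDl scalerA.
move=> i; rewrite -mcoeff_neq0 mcoeffD (scale_lincombE a x) inE.
apply: contraR; rewrite negb_or => /andP[ix iy].
by rewrite !mcoeff_outdom // mulr0 addr0.
Qed.

HB.instance Definition _ V (e : K -> V) :=
  GRing.isLinear.Build k (lincomb k K) V _ (linext e) (linext_linear e).

Lemma linext_single V (e : K -> V) i : linext e (single i) = e i.
Proof.
rewrite (@linextEw _ e [fset i]%fset); last exact/fsubsetP/msuppU_le.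
by rewrite big_seq_fset1 mcoeffUU scale1r.
Qed.

Lemma linext_id x : linext single x = x.
Proof.
rewrite [RHS]monalgE; apply: eq_bigr => i _; apply/malgP => j.
by rewrite (scale_lincombE _ (single i)) !mcoeffU; case: eqP;
  rewrite ?mulr1 ?mulr0.
Qed.

Lemma linear_linext V W (f : {linear V -> W}) (e : K -> V) x :
  f (linext e x) = linext (f \o e) x.
Proof. by rewrite linear_sum; apply: eq_bigr => i _; rewrite linearZ. Qed.

Lemma eq_in_linext V (e e' : K -> V) x :
  (forall i, i \in msupp x -> e i = e' i) -> linext e x = linext e' x.
Proof.
by move=> ee'; apply: eq_big_seq => i /ee' ->.
Qed.

Lemma linextB V (e e' : K -> V) x :
  linext (fun i => e i - e' i) x = linext e x - linext e' x.
Proof. by rewrite -sumrB; apply: eq_bigr => i _; rewrite scalerBr. Qed.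

End Linext.

Section Submodules.
Variables (k : comPzRingType) (K : choiceType).
Implicit Types (x y : lincomb k K) (V W : lmodType k).

Lemma linext_reindex (K' : choiceType) V (e : K' -> V) (g : K -> K') x :
  linext e (linext (fun i => single (g i)) x) = linext (fun i => e (g i)) x.
Proof.
by rewrite linear_linext; apply: eq_in_linext => i _; apply: linext_single.
Qed.

(** A bare predicate rather than a bundled submodule: the sets of interest
    ([consequence], [lin_span G], kernels) are already given as predicates. *)
Definition submodule V (S : V -> Prop) :=
  S 0 /\ forall a u v, S u -> S v -> S (a *: u + v).

Lemma submodule_linext V (S : V -> Prop) (e : K -> V) x :
  submodule S -> (forall i, i \in msupp x -> S (e i)) -> S (linext e x).
Proof.
move=> [S0 SD] Se; rewrite /linext big_seq.
by elim/big_rec: _ => // i u ix Su; apply: SD => //; apply: Se.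
Qed.

Definition supported (Q : K -> Prop) x := forall i, i \in msupp x -> Q i.

Lemma supported_submodule Q : submodule (supported Q).
Proof.
split=> [i|a x y xQ yQ i]; first by rewrite msupp0.
rewrite -mcoeff_neq0 mcoeffD (scale_lincombE a x) => xyi.
case: (boolP (i \in msupp x)) => [/xQ //|xi].
case: (boolP (i \in msupp y)) => [/yQ //|yi].
by move: xyi; rewrite !mcoeff_outdom // mulr0 addr0 eqxx.
Qed.

Lemma supported_single (Q : K -> Prop) i : Q i -> supported Q (single i).
Proof. by move=> Qi j /(fsubsetP msuppU_le); rewrite inE => /eqP ->. Qed.

Lemma lin_span_submodule V (G : V -> Prop) : submodule (lin_span G).
Proof.
split=> [|a u v]; first exact: lin_span0.
elim=> [|b g w Gg _ IHw] Gv; first by rewrite scaler0 add0r.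
rewrite scalerDr scalerA -addrA; apply: lin_spanD => //; exact: IHw.
Qed.

Lemma lin_span_gen V (G : V -> Prop) u : G u -> lin_span G u.
Proof.
by move=> Gu; rewrite -[u]scale1r -[_ *: _]addr0; apply: lin_spanD => //;
  apply: lin_span0.
Qed.

Lemma lin_span_min V (G S : V -> Prop) :
  submodule S -> (forall u, G u -> S u) -> forall u, lin_span G u -> S u.
Proof.
by move=> [S0 SD] GS u; elim=> // a g v /GS Sg _ Sv; apply: SD.
Qed.

Lemma submoduleD V (S : V -> Prop) u v : submodule S -> S u -> S v -> S (u + v).
Proof. by move=> [_ SD] Su Sv; rewrite -[u]scale1r; apply: SD. Qed.

Lemma submoduleN V (S : V -> Prop) u : submodule S -> S u -> S (- u).
Proof. by move=> [S0 SD] Su; rewrite -scaleN1r -[_ *: _]addr0; apply: SD. Qed.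

Lemma submoduleB V (S : V -> Prop) u v : submodule S -> S u -> S v -> S (u - v).
Proof. by move=> SS Su Sv; apply: submoduleD => //; apply: submoduleN. Qed.

Lemma ker_submodule V W (f : {linear V -> W}) : submodule (fun u => f u = 0).
Proof.
by split=> [|a u v fu fv]; rewrite ?linear0 // linearP fu fv scaler0 addr0.
Qed.

Lemma preim_submodule V W (f : {linear V -> W}) (S : W -> Prop) :
  submodule S -> submodule (fun u => S (f u)).
Proof.
by move=> [S0 SD]; split=> [|a u v]; rewrite ?linear0 ?linearP //; apply: SD.
Qed.

End Submodules.

Arguments supported_submodule {k K} Q.
Arguments preim_submodule {k V W} f {S}.

(** * Well-founded recursion *)

Lemma wf_of_no_descent (T : Type) (R : T -> T -> Prop) :
  ~ (exists A : nat -> T, forall i, R (A i.+1) (A i)) -> well_founded R.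
Proof.
move=> dcc x; apply: contrapT => nx; apply: dcc.
have step (u : {x | ~ Acc R x}) : exists v : {x | ~ Acc R x}, R (sval v) (sval u).
  case: u => y ny /=; apply: contrapT => no; apply: ny; constructor=> z zy.
  by apply: contrapT => nz; apply: no; exists (exist _ z nz).
have [f fP] := choice step.
by exists (fun i => sval (iter i f (exist _ x nx))) => i; apply: fP.
Qed.

(** A recursion equation [F] that looks at the unknown function only below the
    current point has a solution; values outside the recursive domain are
    replaced with 0, which locality makes invisible. *)
Lemma wf_recursion (T : Type) (V : zmodType) (R : T -> T -> Prop)
    (F : T -> (T -> V) -> V) :
  well_founded R ->
  (forall x f g, (forall y, R y x -> f y = g y) -> F x f = F x g) ->
  exists N : T -> V, forall x, N x = F x N.
Proof.
move=> wfR Floc.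
pose G x (f : forall y, R y x -> V) :=
  F x (fun y => if pselect (R y x) is left h then f y h else 0).
exists (Fix wfR _ G) => x; rewrite Fix_eq => [|{}x f g fg].
  by apply: Floc => y Ryx; case: pselect.
by apply: Floc => y Ryx; case: pselect.
Qed.

(** * Placements under composition and tensor product *)

Section Isotopy.
Variable Sg : signature.
Implicit Types n m p q : seq (obj Sg).

Lemma piP n m (t u : term n m) :
  isotopic t u -> \pi_(diagram n m) t = \pi_(diagram n m) u.
Proof. by move=> tu; apply/eqmodP/asboolP. Qed.

Lemma pi_isotopic n m (t u : term n m) :
  \pi_(diagram n m) t = \pi_(diagram n m) u -> isotopic t u.
Proof. by move/eqmodP/asboolP. Qed.

Lemma diagramW n m (A : diagram n m) : exists t, A = \pi t.
Proof. by exists (repr A); rewrite reprK. Qed.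

(** Isotopy being heterogeneous, a term may be moved to propositionally equal
    boundaries without a transport occurring in later statements. *)
Lemma cast_ex n m n' m' (t : term n m) :
  n = n' -> m = m' -> exists t' : term n' m', isotopic t' t.
Proof. by move=> en em; subst n' m'; exists t; apply: iso_refl. Qed.

Lemma plugE n m p q a b (t : term (a ++ (q ++ b)) m) (u : term n (a ++ (p ++ b)))
    (w : term p q) :
  plug (Placement (\pi_(diagram _ _) t) (\pi_(diagram _ _) u)) (\pi w) =
  \pi_(diagram n m) (Comp t (Comp (Tens (Id a) (Tens w (Id b))) u)).
Proof. by rewrite /plug /= (hcompE w (Id b)) hcompE (vcompE _ u) (vcompE t). Qed.

Lemma placementW n m p q (c : placement n m p q) :
  exists a b (t : term (a ++ (q ++ b)) m) (u : term n (a ++ (p ++ b))),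
    c = Placement (\pi_(diagram _ _) t) (\pi_(diagram _ _) u).
Proof.
case: c => a b T U; have [t ->] := diagramW T; have [u ->] := diagramW U.
by exists a, b, t, u.
Qed.

(** The trivial placement has empty sides; its top and bottom are identities,
    moved along the unit laws of concatenation. *)
Lemma plug_identity p q :
  exists c : placement p q p q, forall B, plug c B = B.
Proof.
have [t tI] := cast_ex (n' := [::] ++ (q ++ [::])) (Id q) (esym (cats0 q)) erefl.
have [u uI] := cast_ex (m' := [::] ++ (p ++ [::])) (Id p) erefl (esym (cats0 p)).
exists (Placement (\pi_(diagram _ _) t) (\pi_(diagram _ _) u)) => B.
have [w ->] := diagramW B; rewrite plugE; apply: piP.
apply: iso_trans (iso_Comp1l w); apply: iso_Comp tI _.
apply: iso_trans (iso_Comp1r w); apply: iso_Comp uI.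
exact: iso_trans (iso_Tens1l _) (iso_Tens1r _).
Qed.

Lemma plug_vcompl n p' m p q (T : diagram p' m) (c : placement n p' p q) :
  exists c' : placement n m p q, forall B, plug c' B = vcomp T (plug c B).
Proof.
have [a [b [t [u ->]]]] := placementW c; have [v ->] := diagramW T.
exists (Placement (\pi_(diagram _ _) (Comp v t)) (\pi_(diagram _ _) u)) => B.
have [w ->] := diagramW B; rewrite !plugE vcompE; apply: piP.
exact/iso_sym/iso_CompA.
Qed.

Lemma plug_vcompr n n' m p q (U : diagram n' n) (c : placement n m p q) :
  exists c' : placement n' m p q, forall B, plug c' B = vcomp (plug c B) U.
Proof.
have [a [b [t [u ->]]]] := placementW c; have [v ->] := diagramW U.
exists (Placement (\pi_(diagram _ _) t) (\pi_(diagram _ _) (Comp u v))) => B.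
have [w ->] := diagramW B; rewrite !plugE vcompE; apply: piP.
apply: iso_trans (iso_CompA _ _ _); apply: iso_Comp (iso_refl _) _.
exact: iso_CompA.
Qed.

(** With & for the tensor product, the interchange law gives
    T & (t o x o u) = (1 & t) o (1 & x) o (T & u): the diagram T is absorbed
    into the bottom part, and its target widens the left side. *)
Lemma plug_hcompl n m n' m' p q (T : diagram n' m') (c : placement n m p q) :
  exists c' : placement (n' ++ n) (m' ++ m) p q,
    forall B, plug c' B = hcomp T (plug c B).
Proof.
have [a [b [t [u ->]]]] := placementW c; have [v ->] := diagramW T.
have [t' t'E] := cast_ex (Tens (Id m') t) (catA m' a (q ++ b)) erefl.
have [u' u'E] := cast_ex (Tens v u) erefl (catA m' a (p ++ b)).
exists (Placement (\pi_(diagram _ _) t') (\pi_(diagram _ _) u')) => B.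
have [w ->] := diagramW B; rewrite !plugE hcompE; apply: piP; apply: iso_sym.
apply: (iso_trans (iso_Tens (iso_sym (iso_Comp1l v)) (iso_refl _))).
apply: (iso_trans (iso_sym (iso_interchange _ _ _ _))).
apply: iso_Comp (iso_sym t'E) _.
apply: (iso_trans (iso_Tens (iso_sym (iso_Comp1l v)) (iso_refl _))).
apply: (iso_trans (iso_sym (iso_interchange _ _ _ _))).
apply: iso_Comp (iso_sym u'E).
apply: (iso_trans (iso_TensA _ _ _)).
exact: iso_Tens (iso_Tens_Id _ _) (iso_refl _).
Qed.

Lemma plug_hcompr n m n' m' p q (T : diagram n' m') (c : placement n m p q) :
  exists c' : placement (n ++ n') (m ++ m') p q,
    forall B, plug c' B = hcomp (plug c B) T.
Proof.
have [a [b [t [u ->]]]] := placementW c; have [v ->] := diagramW T.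
have eqa r : (a ++ (r ++ b)) ++ m' = a ++ (r ++ (b ++ m')) by rewrite !catA.
have [t' t'E] := cast_ex (Tens t (Id m')) (eqa q) erefl.
have [u' u'E] := cast_ex (Tens u v) erefl (eqa p).
exists (Placement (\pi_(diagram _ _) t') (\pi_(diagram _ _) u')) => B.
have [w ->] := diagramW B; rewrite !plugE hcompE; apply: piP; apply: iso_sym.
apply: (iso_trans (iso_Tens (iso_refl _) (iso_sym (iso_Comp1l v)))).
apply: (iso_trans (iso_sym (iso_interchange _ _ _ _))).
apply: iso_Comp (iso_sym t'E) _.
apply: (iso_trans (iso_Tens (iso_refl _) (iso_sym (iso_Comp1l v)))).
apply: (iso_trans (iso_sym (iso_interchange _ _ _ _))).
apply: iso_Comp (iso_sym u'E).
apply: (iso_trans (iso_sym (iso_TensA _ _ _))).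
apply: iso_Tens (iso_refl _) _.
apply: (iso_trans (iso_sym (iso_TensA _ _ _))).
exact: iso_Tens (iso_refl _) (iso_Tens_Id _ _).
Qed.

End Isotopy.

(** * Subdiagrams recorded as boxes *)

Section BoxedSubdiagrams.
Variables (Sg : signature) (I : Type) (bsrc btgt : I -> seq (obj Sg)).
Local Notation bSg := (box_signature bsrc btgt).
Implicit Types n m : seq (obj Sg).

Lemma embed_term_isotopic n m n' m' (t : term n m) (t' : term n' m') :
  isotopic t t' ->
  isotopic (embed_term bsrc btgt t) (embed_term bsrc btgt t').
Proof.
elim=> /=; intros; first [by constructor | by eapply iso_trans; eassumption
  | exact: (@iso_Tens bSg) | exact: (@iso_TensA bSg) | exact: (@iso_Tens1l bSg)
  | exact: (@iso_Tens1r bSg) | exact: (@iso_Tens_Id bSg) | exact: (@iso_interchange bSg)].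
Qed.

Lemma embedE n m (t : term n m) :
  embed bsrc btgt (\pi t) = \pi_(@diagram bSg n m) (embed_term bsrc btgt t).
Proof. by apply: piP; apply/embed_term_isotopic/isotopic_repr. Qed.

(** The strict monoidal functor that is the identity on the generators of [Sg]
    and sends the box labelled [r] to [F r]. *)
Fixpoint fill_boxes (F : forall r, @term Sg (bsrc r) (btgt r))
    (n m : seq (obj bSg)) (t : @term bSg n m) : @term Sg n m :=
  match t in term n' m' return @term Sg n' m' with
  | Id a => @Id Sg a
  | Gen (inl s) => @Gen Sg s
  | Gen (inr r) => F r
  | Comp _ _ _ u v => Comp (fill_boxes F u) (fill_boxes F v)
  | Tens _ _ _ _ u v => Tens (fill_boxes F u) (fill_boxes F v)
  end.

Lemma fill_boxes_isotopic F (n m n' m' : seq (obj bSg))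
    (t : @term bSg n m) (t' : @term bSg n' m') :
  isotopic t t' -> isotopic (fill_boxes F t) (fill_boxes F t').
Proof.
elim=> /=; intros; first [by constructor | by eapply iso_trans; eassumption
  | exact: (@iso_Tens Sg) | exact: (@iso_TensA Sg) | exact: (@iso_Tens1l Sg)
  | exact: (@iso_Tens1r Sg) | exact: (@iso_Tens_Id Sg) | exact: (@iso_interchange Sg)].
Qed.

Lemma fill_boxes_embed F n m (t : @term Sg n m) :
  fill_boxes F (embed_term bsrc btgt t) = t.
Proof. by elim: t => //= [> -> > ->|> -> > ->]. Qed.

(** Every axiom of strict monoidal categories preserves the number of
    occurrences of each generator, so this is an isotopy invariant. *)
Fixpoint num_boxes (r : I) (n m : seq (obj bSg)) (t : @term bSg n m) : nat :=
  match t with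
  | Id _ => 0%N
  | Gen (inl _) => 0%N
  | Gen (inr s) => `[< s = r >]
  | Comp _ _ _ u v => (num_boxes r u + num_boxes r v)%N
  | Tens _ _ _ _ u v => (num_boxes r u + num_boxes r v)%N
  end.

Lemma num_boxes_isotopic r (n m n' m' : seq (obj bSg))
    (t : @term bSg n m) (t' : @term bSg n' m') :
  isotopic t t' -> num_boxes r t = num_boxes r t'.
Proof.
elim=> //=; intros; lia.
Qed.

Lemma num_boxes_embed r n m (t : @term Sg n m) :
  num_boxes r (embed_term bsrc btgt t) = 0%N.
Proof. by elim: t => //= [> -> > ->|> -> > ->]. Qed.

Definition boxed_term r n m a b
    (t : @term Sg (a ++ (btgt r ++ b)) m) (u : @term Sg n (a ++ (bsrc r ++ b))) :
    @term bSg n m :=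
  Comp (embed_term bsrc btgt t)
    (Comp (Tens (@Id bSg a) (Tens (@Gen bSg (inr r)) (@Id bSg b)))
          (embed_term bsrc btgt u)).

Lemma boxedE r n m a b
    (t : @term Sg (a ++ (btgt r ++ b)) m) (u : @term Sg n (a ++ (bsrc r ++ b))) :
  boxed (r := r) (Placement (\pi_(diagram _ _) t) (\pi_(diagram _ _) u)) =
  \pi_(@diagram bSg n m) (boxed_term t u).
Proof. by rewrite /boxed /= (embedE t) (embedE u) (@plugE bSg). Qed.

(** The diagram [boxed c] contains one box, labelled [r], so its label can be
    read off by [num_boxes]. *)
Lemma boxed_eq_label n m r s (c : placement n m (bsrc r) (btgt r))
    (d : placement n m (bsrc s) (btgt s)) :
  boxed c = boxed d -> r = s.
Proof.
have [a [b [t [u ->]]]] := placementW c.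
have [a' [b' [t' [u' ->]]]] := placementW d.
rewrite !boxedE => /pi_isotopic/(num_boxes_isotopic s).
rewrite /= !num_boxes_embed !addn0 !add0n.
by rewrite (asboolT (erefl s)); case: asboolP.
Qed.

(** Filling the box of [boxed c] with [B] gives back [plug c B].  The terms
    assumed for all labels extend a filling of the boxes labelled [r] to a
    monoidal functor. *)
Lemma boxed_eq_plug n m r (c d : placement n m (bsrc r) (btgt r)) :
  (forall s, @term Sg (bsrc s) (btgt s)) ->
  boxed c = boxed d -> forall B, plug c B = plug d B.
Proof.
move=> G.
have [a [b [t [u ->]]]] := placementW c.
have [a' [b' [t' [u' ->]]]] := placementW d.
rewrite !boxedE => /pi_isotopic tu B; have [w ->] := diagramW B.
pose F s := if pselect (r = s) is left e
  then ecast s (@term Sg (bsrc s) (btgt s)) e w else G s.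
have Fr : F r = w.
  by rewrite /F; case: pselect => // e; rewrite (Prop_irrelevance e erefl).
rewrite !plugE; apply: piP.
by have := fill_boxes_isotopic F tu; rewrite /= Fr !fill_boxes_embed.
Qed.

End BoxedSubdiagrams.

(** * Consequences of the relations *)

Section Presentation.
Variables (k : comPzRingType) (P : presentation k).
Implicit Types n m p q : seq (obj P).

Lemma lplug_single n m p q (c : placement n m p q) B :
  lplug c (single B) = single (plug c B) :> lincomb k (diagram n m).
Proof. exact: linext_single. Qed.

Lemma lplug_map n m n' m' p q (c : placement n m p q) (c' : placement n' m' p q)
    (f : diagram n m -> diagram n' m') (x : lincomb k (diagram p q)) :
  (forall B, plug c' B = f (plug c B)) ->
  linext (fun A => single (f A) : lincomb k _) (lplug c x) = lplug c' x.
Proof.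
move=> c'f; rewrite /lplug linext_reindex.
by apply: eq_in_linext => B _; rewrite c'f.
Qed.

Lemma consequence_submodule n m : submodule (@consequence k P n m).
Proof. by split; [apply: cons0 | apply: cons_lin]. Qed.

Lemma consequence_lplug n m p q (c : placement n m p q)
    (x : lincomb k (diagram p q)) :
  consequence x -> consequence (lplug c x).
Proof.
case: c => a b T U xP.
have := cons_vcompl T (cons_vcompr U
          (cons_hcompl (idd a) (cons_hcompr (idd b) xP))).
by rewrite !linext_reindex.
Qed.

Lemma toHom_eq0 n m (x : lincomb k (diagram n m)) :
  toHom x = 0 <-> consequence x.
Proof.
have -> : (0 : HomC (P := P) n m) = toHom 0.
  by apply: (addIr (toHom 0)); rewrite -toHomD !add0r.
rewrite /toHom; split=> [/eqP|xP]; first by rewrite -Quotient.idealrBE subr0 => /asboolP.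
by apply/eqP; rewrite -Quotient.idealrBE subr0; apply/asboolP.
Qed.

Fact toHom_linear n m : linear (@toHom k P n m).
Proof. by move=> a x y; rewrite toHomD toHomZ. Qed.

HB.instance Definition _ n m := GRing.isLinear.Build k (lincomb k (diagram n m))
  (HomC (P := P) n m) _ (@toHom k P n m) (@toHom_linear n m).

Lemma linext_toHom n m (x : lincomb k (diagram n m)) :
  linext (fun A => toHom (single A) : HomC (P := P) n m) x = toHom x.
Proof. by rewrite -[in RHS](linext_id x) linear_linext. Qed.

End Presentation.

(** * Resolutions *)

Section Rewriting.
Variables (k : comPzRingType) (P : presentation k) (O : orientation P).
Implicit Types n m p q : seq (obj P).

Definition rule r : lincomb k _ := single (lead O r) - rest O r.

Lemma lplug_rule n m r (c : placement n m (rsrc r) (rtgt r)) :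
  lplug c (rule r) = single (plug c (lead O r)) - lplug c (rest O r).
Proof. by rewrite -lplug_single /lplug raddfB. Qed.

Lemma elem_resolution_single n m r (c : placement n m (rsrc r) (rtgt r)) A :
  elem_resolution O c (single A) =
  if A == plug c (lead O r) then lplug c (rest O r) else single A.
Proof. exact: linext_single. Qed.

Lemma resolutionE n m (rho : lincomb k (diagram n m) -> _) x :
  resolution O rho -> rho x = linext (fun A => rho (single A)) x.
Proof.
move=> rhoP; elim: rhoP x => [|r c {}rho _ IH] x /=; first by rewrite linext_id.
by rewrite {1}IH /elem_resolution linear_linext.
Qed.

Lemma resolution_trans n m (rho sigma : lincomb k (diagram n m) -> _) :
  resolution O rho -> resolution O sigma -> resolution O (rho \o sigma).
Proof.
move=> rhoP sigmaP; elim: rhoP => [|r c {}rho _ IH]; first exact: sigmaP.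
exact: (resolution_comp c IH).
Qed.

Lemma resolution_elem n m r (c : placement n m (rsrc r) (rtgt r)) :
  resolution O (elem_resolution O c).
Proof. exact: resolution_comp (resolution_id _ _ _). Qed.

Lemma reducible_redex n m (A : diagram n m) :
  ~ irreducible O A -> exists r (c : placement n m (rsrc r) (rtgt r)),
    A = plug c (lead O r).
Proof.
move=> nA; apply: contrapT => no; apply: nA => rho.
elim=> [//|r c {}rho _ IH] /=; rewrite IH elem_resolution_single.
by case: eqP => // Ac; case: no; exists r, c.
Qed.

(** Over a nontrivial ring an irreducible diagram contains no leading diagram.
    This form of the fact also holds over the zero ring, where every diagram is
    irreducible. *)
Lemma irreducible_redex n m r (c : placement n m (rsrc r) (rtgt r)) :
  irreducible O (plug c (lead O r)) -> lplug c (rule r) = 0.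
Proof.
move=> /(_ _ (resolution_elem c)); rewrite elem_resolution_single eqxx lplug_rule.
by move->; rewrite subrr.
Qed.

Lemma resolution_irreducible n m (rho : lincomb k (diagram n m) -> _) x :
  resolution O rho -> supported (irreducible O (m := m)) x -> rho x = x.
Proof.
move=> rhoP xirr; rewrite (resolutionE _ rhoP) -[RHS]linext_id.
by apply: eq_in_linext => A /xirr /(_ _ rhoP).
Qed.

(** An elementary resolution moves an element by a multiple of one
    [lplug c (rule r)].  Closure of [Q] under the applicable rules is asked for
    because the later steps act on what the earlier ones produced. *)
Lemma resolution_modulo n m (Q : diagram n m -> Prop)
    (S : lincomb k (diagram n m) -> Prop) rho x :
  submodule S ->
  (forall r (c : placement n m (rsrc r) (rtgt r)), Q (plug c (lead O r)) ->
     supported Q (lplug c (rest O r)) /\ S (lplug c (rule r))) ->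
  resolution O rho -> supported Q x -> supported Q (rho x) /\ S (x - rho x).
Proof.
move=> SS QS rhoP xQ; elim: rhoP => [|r c {}rho _ [yQ Sy]] /=.
  by rewrite subrr; split=> //; case: SS.
move: (rho x) yQ Sy => y yQ Sy; split.
  rewrite /elem_resolution; apply: (submodule_linext (supported_submodule Q)) => A /yQ QA.
  by case: eqP => [Ac|_]; [apply: (QS _ _ _).1; rewrite -Ac | apply: supported_single].
rewrite -[x](subrK y) -addrA; apply: submoduleD Sy _ => //.
rewrite -[in X in S (X - _)](linext_id y) -linextB.
apply: (submodule_linext SS) => A /yQ QA; case: eqP => [Ac|_].
  by rewrite {1}Ac -lplug_rule; apply: (QS _ _ _).2; rewrite -Ac.
by rewrite subrr; case: SS.
Qed.

(** The part of compatibility that does not involve the order. *)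
Definition unitary_relators :=
  forall r : relT P, exists u v : k, v * u = 1 /\ relator r = u *: rule r.

Section Consequences.
Hypothesis relators : unitary_relators.

Lemma consequence_rule n m r (c : placement n m (rsrc r) (rtgt r)) :
  consequence (lplug c (rule r)).
Proof.
apply: consequence_lplug; have [u [v [vu relE]]] := relators r.
rewrite -[rule r]scale1r -vu -scalerA -relE -[_ *: _]addr0.
by apply: cons_lin (cons_relator r) (cons0 _ _).
Qed.

Lemma consequence_resolution n m (rho : lincomb k (diagram n m) -> _) x :
  resolution O rho -> consequence (x - rho x).
Proof.
move=> rhoP; apply: (@resolution_modulo n m (fun _ => True) _ rho x _ _ rhoP _).2 => //.
  exact: consequence_submodule.
by move=> r c _; split=> //; apply: consequence_rule.
Qed.

Definition rule_span n m : lincomb k (diagram n m) -> Prop :=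
  lin_span (fun x => exists r (c : placement n m (rsrc r) (rtgt r)),
                       x = lplug c (rule r)).

Lemma rule_span_map n m n' m' (f : diagram n m -> diagram n' m')
    (x : lincomb k (diagram n m)) :
  (forall p q (c : placement n m p q), exists c' : placement n' m' p q,
     forall B, plug c' B = f (plug c B)) ->
  rule_span x -> rule_span (linext (fun A => single (f A)) x).
Proof.
move=> fP.
pose F : lincomb k _ -> lincomb k _ := linext (fun A => single (f A)).
apply: (lin_span_min (S := fun y => rule_span (F y))).
  exact: (preim_submodule F (lin_span_submodule _)).
move=> _ [r [c ->]]; have [c' c'P] := fP _ _ c.
by apply: lin_span_gen; exists r, c'; rewrite /F (lplug_map _ c'P).
Qed.

(** The span of the [lplug c (rule r)] is already closed under composition and
    tensor product with diagrams, since these turn placements into placements;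
    so the ideal generated by the relators is no larger. *)
Lemma consequence_span n m (x : lincomb k (diagram n m)) :
  consequence x -> rule_span x.
Proof.
elim=> {n m x}.
- move=> r; have [u [v [_ ->]]] := relators r; rewrite -[_ *: _]addr0.
  apply: lin_spanD; last exact: lin_span0.
  have [c cP] := plug_identity (rsrc r) (rtgt r); exists r, c.
  by rewrite -(lplug_map (c := c) (f := id) _ (fun=> erefl)) linext_id
    /lplug -[LHS]linext_id; apply: eq_in_linext => B _; rewrite cP.
- by move=> n m; apply: lin_span0.
- by move=> n m a x y _ xS _ yS; apply: (lin_span_submodule _).2.
- by move=> n p m T x _; apply: rule_span_map => q q' c; apply: plug_vcompl.
- by move=> n p m U x _; apply: rule_span_map => q q' c; apply: plug_vcompr.
- by move=> n m n' m' T x _; apply: rule_span_map => q q' c; apply: plug_hcompl.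
- by move=> n m n' m' T x _; apply: rule_span_map => q q' c; apply: plug_hcompr.
Qed.

End Consequences.

(** * Normalization and the diamond argument *)

Section Order.
Variable le : rel (anydiagram P).
Hypothesis le_order : partial_order le.
Hypothesis le_monoidal : monoidal_order le.
Hypothesis le_compatible : compatible O le.
Hypothesis le_dcc : descending_chain_condition le.

Definition hlt n m (B A : diagram n m) : Prop :=
  lt le (AnyDiagram B) (AnyDiagram A).
Definition below n m (A : diagram n m) : lincomb k (diagram n m) -> Prop :=
  supported (fun B => hlt B A).

Let relators : unitary_relators.
Proof. by move=> r; have [[u [v [? ?]]] _] := le_compatible r; exists u, v. Qed.

Lemma hlt_trans n m (C B A : diagram n m) : hlt C B -> hlt B A -> hlt C A.
Proof.
have [_ anti trans] := le_order.
move=> /andP[CB lCB] /andP[BA lBA]; apply/andP; split; last exact: trans lCB lBA.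
by apply: contra CB => /eqP CA; apply/eqP/anti; rewrite lCB CA lBA.
Qed.

Lemma hlt_wf n m : well_founded (@hlt n m).
Proof.
apply: wf_of_no_descent => -[A Adesc]; apply: le_dcc.
by exists (fun i => AnyDiagram (A i)).
Qed.

Lemma rest_below n m r (c : placement n m (rsrc r) (rtgt r)) :
  below (plug c (lead O r)) (lplug c (rest O r)).
Proof.
apply: (submodule_linext (supported_submodule (fun B => hlt B _))) => B.
move=> /((le_compatible r).2 B) Br; apply: supported_single.
exact: le_monoidal.
Qed.

Lemma resolution_below n m (A : diagram n m) rho x :
  resolution O rho -> below A x ->
  below A (rho x) /\ ideal_below O le A (x - rho x).
Proof.
apply: resolution_modulo; first exact: lin_span_submodule.
move=> r c ltA; split; first by move=> B /rest_below BC; apply: hlt_trans BC ltA.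
by apply: lin_span_gen; exists r, c.
Qed.

(** As long as a resolution has not changed [A] it acts trivially; once it has,
    the result lies below [A] and remains there. *)
Lemma resolution_single n m (A : diagram n m) rho :
  resolution O rho -> rho (single A) = single A \/ below A (rho (single A)).
Proof.
elim=> [|r c {}rho _ /= [->|Ab]]; [by left| |right].
  rewrite elem_resolution_single; case: eqP => [->|_]; [right | by left].
  exact: rest_below.
exact: (resolution_below (resolution_elem c) Ab).1.
Qed.

Definition normalizable n m (x : lincomb k (diagram n m)) :=
  exists2 rho, resolution O rho & supported (irreducible O (m := m)) (rho x).

(** Normalizing the terms of a combination one after the other, the resolution
    used for one term also acts on the following ones; therefore normalizability
    is required after an arbitrary resolution. *)
Definition hereditarily_normalizable n m (A : diagram n m) :=
  forall sigma, resolution O sigma -> normalizable (sigma (single A)).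

(** Terms that are already normalized are combinations of irreducible diagrams,
    and are not disturbed by the resolutions that normalize the next ones. *)
Lemma normalizable_seq n m (s : seq (diagram n m)) sigma :
  (forall A, A \in s -> hereditarily_normalizable A) -> resolution O sigma ->
  exists2 rho, resolution O rho & forall A, A \in s ->
    supported (irreducible O (m := m)) (rho (sigma (single A))).
Proof.
elim: s sigma => [|A s IH] sigma sP sigmaP; first by exists id => //; apply: resolution_id.
have [rho rhoP Airr] := sP A (mem_head _ _) _ sigmaP.
have [|tau tauP tauirr] := IH _ _ (resolution_trans rhoP sigmaP).
  by move=> B Bs; apply: sP; rewrite inE Bs orbT.
exists (tau \o rho); first exact: resolution_trans.
move=> B; rewrite inE => /predU1P[->|/tauirr //] /=.
by rewrite (resolution_irreducible tauP Airr).
Qed.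

Lemma normalizable_supported n m (x : lincomb k (diagram n m)) :
  supported (hereditarily_normalizable (m := m)) x -> normalizable x.
Proof.
move=> xP; have [rho rhoP rhoirr] := normalizable_seq xP (resolution_id O n m).
exists rho => //; rewrite (resolutionE _ rhoP).
exact: (submodule_linext (supported_submodule _)) rhoirr.
Qed.

Lemma hereditarily_normalizableP n m (A : diagram n m) :
  hereditarily_normalizable A.
Proof.
elim/(well_founded_ind (@hlt_wf n m)): A => A IH sigma sigmaP.
have belowN x : below A x -> normalizable x.
  by move=> xA; apply: normalizable_supported => B /xA; apply: IH.
have [->|/belowN//] := resolution_single A sigmaP.
have [Airr|/reducible_redex[r [c Ac]]] := pselect (irreducible O A).
  by exists id; [apply: resolution_id | apply: supported_single].
have := @rest_below n m r c; rewrite -Ac => /belowN[rho rhoP rhoirr].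
exists (rho \o elem_resolution O c); first exact: resolution_trans (resolution_elem c).
by rewrite /= elem_resolution_single -Ac eqxx.
Qed.

Lemma normalizableP n m (x : lincomb k (diagram n m)) : normalizable x.
Proof. by apply: normalizable_supported => A _; apply: hereditarily_normalizableP. Qed.

(** Normalize the two branches: the results represent the same morphism, and
    both are combinations of irreducible diagrams. *)
Lemma basis_resolvable :
  irreducible_basis O -> forall a : ambiguity O, resolvable a.
Proof.
move=> basis a.
have conseq1 : consequence (single (adiag a) - branch1 a).
  exact: (consequence_resolution relators _ (resolution_elem (apos1 a))).
have conseq2 : consequence (single (adiag a) - branch2 a).
  exact: (consequence_resolution relators _ (resolution_elem (apos2 a))).
have [rho1 rho1P irr1] := normalizableP (branch1 a).
have [rho2 rho2P irr2] := normalizableP (branch2 a).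
exists rho1, rho2; split=> //; apply/eqP; rewrite -subr_eq0; apply/eqP.
apply: (basis _ _).1; first exact: submoduleB (supported_submodule _) irr1 irr2.
rewrite linext_toHom; apply/toHom_eq0.
have toZ x : consequence (single (adiag a) - x) -> forall rho, resolution O rho ->
    consequence (single (adiag a) - rho x).
  move=> xP rho rhoP; rewrite -[single _](subrK x) -addrA.
  by apply: (submoduleD (consequence_submodule _ _) xP);
    apply: consequence_resolution.
rewrite -[rho1 _](subrK (single (adiag a))) -addrA.
apply: (submoduleD (consequence_submodule _ _)) (toZ _ conseq2 _ rho2P).
by rewrite -opprB; apply: (submoduleN (consequence_submodule _ _)) (toZ _ conseq1 _ rho1P).
Qed.

(** If both branches resolve to a common z, their difference is the sum of the
    displacements of branch 1 to z and of z to branch 2. *)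
Lemma resolvable_relative (a : ambiguity O) :
  resolvable a -> relatively_resolvable le a.
Proof.
move=> [rho1 [rho2 [rho1P rho2P eq12]]].
have below1 : below (adiag a) (branch1 a).
  by rewrite /branch1 elem_resolution_single {2}(adiag1 a) eqxx {1}(adiag1 a);
    apply: rest_below.
have below2 : below (adiag a) (branch2 a).
  by rewrite /branch2 elem_resolution_single {2}(adiag2 a) eqxx {1}(adiag2 a);
    apply: rest_below.
rewrite /relatively_resolvable.
have -> : branch1 a - branch2 a =
    (branch1 a - rho1 (branch1 a)) - (branch2 a - rho2 (branch2 a)).
  by rewrite -eq12 opprB addrA subrK.
apply: submoduleB; first exact: lin_span_submodule.
  exact: (resolution_below rho1P below1).2.
exact: (resolution_below rho2P below2).2.
Qed.

Lemma one_step n m :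
  exists step : diagram n m -> lincomb k (diagram n m), forall A,
    ~ irreducible O A -> exists r (c : placement n m (rsrc r) (rtgt r)),
      A = plug c (lead O r) /\ step A = lplug c (rest O r).
Proof.
suff /choice[step stepP] : forall A, exists y, ~ irreducible O A ->
    exists r (c : placement n m (rsrc r) (rtgt r)),
      A = plug c (lead O r) /\ y = lplug c (rest O r).
  by exists step.
move=> A; have [Airr|/reducible_redex[r [c Ac]]] := pselect (irreducible O A).
  by exists 0.
by exists (lplug c (rest O r)) => _; exists r, c.
Qed.

(** The normal form map for a fixed choice of reductions.  Its recursion is
    well-founded since the terms of [lplug c (rest O r)] lie below
    [plug c (lead O r)]. *)
Lemma normal_form_exists n m :
  exists N : diagram n m -> lincomb k (diagram n m),
    (forall A, irreducible O A -> N A = single A) /\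
    (forall A, ~ irreducible O A -> exists r (c : placement n m (rsrc r) (rtgt r)),
      A = plug c (lead O r) /\ N A = linext N (lplug c (rest O r))).
Proof.
have [step stepP] := one_step n m.
have [|N NE] := @wf_recursion _ _ _
  (fun A f => if `[< irreducible O A >] then single A else linext f (step A))
  (@hlt_wf n m).
  move=> A f g fg; case: asboolP => // /stepP[r [c [Ac ->]]].
  by apply: eq_in_linext => B BA; apply: fg; rewrite Ac; apply: rest_below BA.
exists N; split=> A Airr; rewrite NE; first by rewrite asboolT.
rewrite asboolF //; have [r [c [Ac stepE]]] := stepP A Airr.
by exists r, c; rewrite stepE.
Qed.

(** The diamond argument: relative resolvability makes the normal form
    independent of the chosen reductions. *)
Lemma normal_form_rule n m (N : diagram n m -> lincomb k (diagram n m)) :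
  (forall a : ambiguity O, relatively_resolvable le a) ->
  (forall A, ~ irreducible O A -> exists r (c : placement n m (rsrc r) (rtgt r)),
     A = plug c (lead O r) /\ N A = linext N (lplug c (rest O r))) ->
  forall r (c : placement n m (rsrc r) (rtgt r)),
    linext N (lplug c (rule r)) = 0.
Proof.
move=> rel Nstep r c.
move: {1}(plug _ _) (erefl (plug c (lead O r))) => A.
elim/(well_founded_ind (@hlt_wf n m)): A r c => A IH r c Ac.
(* The induction hypothesis covers all generators of the ideal below A. *)
have killed : forall x, ideal_below O le A x -> linext N x = 0.
  apply: lin_span_min; first exact: (ker_submodule (linext N)).
  by move=> _ [s [d [dA ->]]]; apply: IH dA _ _ _.
have [Airr|/Nstep[s [d [Ad NA]]]] := pselect (irreducible O A).
  by rewrite irreducible_redex -?Ac // linear0.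
rewrite lplug_rule -Ac linearB /= linext_single NA -linearB.
(* What remains is to compare the reduction along c with the chosen one, d. *)
have [same|distinct] := pselect (boxed d = boxed c).
  have sr := boxed_eq_label same; subst s.
  have plugE := boxed_eq_plug (fun r => repr (lead O r)) same.
  rewrite [X in _ - X](_ : _ = lplug d (rest O r)) ?subrr ?linear0 //.
  by apply: eq_in_linext => B _; rewrite plugE.
have := killed _ (rel (Ambiguity Ad Ac distinct)).
by rewrite /branch1 /branch2 /= !elem_resolution_single -Ad -Ac eqxx.
Qed.

(** A combination of irreducible diagrams that is zero in the category equals
    its own normal form, which vanishes because it is a consequence. *)
Lemma relative_basis :
  (forall a : ambiguity O, relatively_resolvable le a) -> irreducible_basis O.
Proof.
move=> rel n m; split=> [x xirr|v].
  rewrite linext_toHom => /toHom_eq0/(consequence_span relators) xspan.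
  have [N [Nirr Nstep]] := normal_form_exists n m.
  transitivity (linext N x).
    by rewrite -[LHS]linext_id; apply: eq_in_linext => A /xirr /Nirr.
  move: x xspan {xirr}; apply: lin_span_min; first exact: (ker_submodule (linext N)).
  by move=> _ [r [c ->]]; apply: normal_form_rule.
have [y ->] := toHom_surj v; have [rho rhoP yirr] := normalizableP y.
exists (rho y) => //; rewrite linext_toHom; apply/eqP; rewrite -subr_eq0 -linearB.
exact/eqP/toHom_eq0/consequence_resolution.
Qed.

End Order.
End Rewriting.

Theorem theorem4p4 (k : comPzRingType) (P : presentation k)
    (O : orientation P) (le : rel (anydiagram P)) :
  partial_order le ->
  respects_morphism_spaces le ->
  monoidal_order le ->
  compatible O le ->
  descending_chain_condition le ->
  [<-> irreducible_basis O;
       forall a : ambiguity O, resolvable a;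
       forall a : ambiguity O, relatively_resolvable le a]
  /\
  forall M : ambiguity O -> Prop,
    minimal_for (@resolvable k P O) M ->
    [/\ irreducible_basis O <-> (forall a, M a -> resolvable a),
        irreducible_basis O -> (forall a, M a -> relatively_resolvable le a) &
        minimal_for (@relatively_resolvable k P O le) M ->
          (forall a, M a -> relatively_resolvable le a) ->
          irreducible_basis O].
Proof.
move=> ord _ mon comp dcc.
have basis_res := basis_resolvable ord mon comp dcc.
have res_rel := resolvable_relative ord mon comp.
have rel_basis := relative_basis ord mon comp dcc.
split=> [|M Mres]; first by tfae=> // res a; apply: res_rel.
split=> [|/basis_res res a _|Mrel relM]; [split=> [/basis_res//|resM]| |].
- by apply: rel_basis => a; apply/res_rel/Mres.
- exact: res_rel.
- by apply: rel_basis => a; apply: Mrel.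
Qed.
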